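(* Let $(M,H,G)$ be a quaternionic Kähler NH-manifold determined by a non-zero local 1-form $\omega_1$ through $$(\nabla_xJ_1)y=0,\qquad (\nabla_xJ_2)y=\omega_1(x)J_3y,\qquad (\nabla_xJ_3)y=-\omega_1(x)J_2y,$$ where $\omega_1(x)=-\theta_2(J_3x)=\theta_3(J_2x)$. Then $(M,H,G)$ is flat and non-hyper-Kähler if and only if $\omega_1$ is closed.
   Context: $M$ is a smooth manifold of dimension $4n$. An almost hypercomplex structure on $M$ is a triple $H=(J_1,J_2,J_3)$ of almost complex structures with $J_\alpha=J_\beta\circ J_\gamma=-J_\gamma\circ J_\beta$ and $J_\alpha^2=-I$ for all cyclic permutations $(\alpha,\beta,\gamma)$ of $(1,2,3)$. Put $\varepsilon_1=1$, $\varepsilon_2=\varepsilon_3=-1$. An NH-metric structure $G=(g,g_1,g_2,g_3)$ on $(M,H)$ consists of a pseudo-Riemannian metric $g$ of neutral signature $(2n,2n)$ with $g(x,y)=\varepsilon_\alpha g(J_\alpha x,J_\alpha y)$ for $\alpha=1,2,3$, together with $g_\alpha(x,y)=g(J_\alpha x,y)=-\varepsilon_\alpha g(x,J_\alpha y)$. $(M,H,G)$ is then an almost hypercomplex NH-manifold. Let $\nabla$ be the Levi-Civita connection of $g$. $(M,H,G)$ is a quaternionic Kähler NH-manifold if there are (local) 1-forms $\omega_1,\omega_2,\omega_3$ with $(\nabla_xJ_\alpha)y=\omega_\gamma(x)J_\beta y-\omega_\beta(x)J_\gamma y$ for all cyclic permutations $(\alpha,\beta,\gamma)$ of $(1,2,3)$.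 It is hyper-Kähler if $\nabla J_\alpha=0$ for $\alpha=1,2,3$. Non-zero means not identically zero. Let $F_\alpha(x,y,z)=g((\nabla_xJ_\alpha)y,z)$ and $\theta_\alpha(z)=g^{ij}F_\alpha(e_i,e_j,z)$ for a basis $\{e_i\}$ of the tangent space. Flat means that the curvature tensor of $\nabla$ vanishes. *)

(* Defs.v *)
From HB Require Import structures.
From mathcomp Require Import all_boot all_order all_algebra.
From mathcomp Require Import all_classical all_reals all_analysis.
From mathcomp Require Import ring.

Set Implicit Arguments.
Unset Strict Implicit.
Unset Printing Implicit Defensive.
Import Order.TTheory GRing.Theory Num.Theory.
Import numFieldNormedType.Exports.
Local Open Scope classical_set_scope.
Local Open Scope ring_scope.

Section euclidean_smoothness.
Context {R : realType} {m : nat}.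
Implicit Types (U : set 'rV[R]_m) (f g : 'rV[R]_m -> R).

(* The partial derivatives of [f] of order at most [k] exist and are
   continuous on [U]; [U] is meant to be open. *)
Fixpoint Ck (k : nat) U f : Prop :=
  (forall x, U x -> {for x, continuous f}) /\
  if k is k'.+1 then
    forall j : 'I_m, (forall x, U x -> derivable f x (delta_mx 0 j)) /\
      Ck k' U (fun x => 'D_(delta_mx 0 j) f x)
  else True.

Definition Cinfty U f := forall k, Ck k U f.

Lemma near_open U (P : set 'rV[R]_m) x : open U -> U x ->
  (forall y, U y -> P y) -> \forall y \near x, P y.
Proof. by move=> oU Ux UP; apply: filterS UP _; exact: open_nbhs_nbhs. Qed.

Lemma Ck_ext k U f g : open U -> (forall x, U x -> f x = g x) ->
  Ck k U f -> Ck k U g.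
Proof.
move=> oU; elim: k f g => [|k IH] f g fg [cf Hf].
all: have nfg x : U x -> \forall y \near x, f y = g y
  by move=> Ux; exact: near_open oU Ux fg.
all: have cg x : U x -> {for x, continuous g} by
  (move=> Ux; rewrite /prop_for /continuous_at -(fg x Ux);
   apply: cvg_trans (cf x Ux); exact: near_eq_cvg (nfg x Ux)).
  by split.
split=> // j; have [df Df] := Hf j; split=> [x Ux|].
  exact: near_eq_derivable (nfg x Ux) (df x Ux).
by apply: IH Df => x Ux; apply: near_eq_derive; exact: nfg.
Qed.

Lemma CkS k U f : Ck k.+1 U f -> Ck k U f.
Proof.
elim: k f => [|k IH] f [cf Hf]; first by split.
by split=> // j; have [df /IH Df] := Hf j.
Qed.

Lemma Ck_cst k U (a : R) : open U -> Ck k U (fun=> a).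
Proof.
move=> oU; elim: k a => [|k IH] a; split=> //; try by move=> x _; exact: cst_continuous.
move=> j; split=> [x _|]; first exact: (derivable_cst a x (delta_mx 0 j)).
by apply: Ck_ext (IH 0) => // x _; rewrite derive_cst.
Qed.

Lemma CkD k U f g : open U -> Ck k U f -> Ck k U g ->
  Ck k U (fun x => f x + g x).
Proof.
move=> oU; elim: k f g => [|k IH] f g [cf Hf] [cg Hg]; split=> //;
  try by move=> x Ux; exact: (continuousD (cf x Ux) (cg x Ux)).
move=> j; have [df Df] := Hf j; have [dg Dg] := Hg j; split=> [x Ux|].
  exact: derivableD (df x Ux) (dg x Ux).
apply: Ck_ext (IH _ _ Df Dg) => // x Ux.
by rewrite -(deriveD (df x Ux) (dg x Ux)).
Qed.

Lemma CkM k U f g : open U -> Ck k U f -> Ck k U g ->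
  Ck k U (fun x => f x * g x).
Proof.
move=> oU; elim: k f g => [|k IH] f g Cf Cg; move: (Cf) (Cg) => [cf Hf] [cg Hg];
  split=> //; try by move=> x Ux; exact: (continuousM (cf x Ux) (cg x Ux)).
move=> j; have [df Df] := Hf j; have [dg Dg] := Hg j; split=> [x Ux|].
  exact: derivableM (df x Ux) (dg x Ux).
apply: Ck_ext (CkD oU (IH _ _ (CkS Cf) Dg) (IH _ _ (CkS Cg) Df)) => // x Ux.
by rewrite -(deriveM (df x Ux) (dg x Ux)).
Qed.

End euclidean_smoothness.

Record chart (R : realType) (m : nat) (M : topologicalType) := Chart {
  chart_dom : set M ;
  chart_map :> M -> 'rV[R]_m ;
  chart_inv : 'rV[R]_m -> M ;
  chart_dom_open : open chart_dom ;
  chart_cod_open : open (chart_map @` chart_dom) ;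
  chart_mapK : {in chart_dom, cancel chart_map chart_inv} ;
  chart_map_cont : {in chart_dom, continuous chart_map} ;
  chart_inv_cont : {in chart_map @` chart_dom, continuous chart_inv} }.

Record smooth_manifold (R : realType) (m : nat) := SmoothManifold {
  manifold_carrier :> topologicalType ;
  manifold_hausdorff : hausdorff_space manifold_carrier ;
  manifold_second_countable : @second_countable manifold_carrier ;
  atlas : set (chart R m manifold_carrier) ;
  atlas_cover : forall p, exists2 c, atlas c & chart_dom c p ;
  atlas_compatible : forall c c', atlas c -> atlas c' -> forall j : 'I_m,
    Cinfty (c @` (chart_dom c `&` chart_dom c'))
      (fun x => c' (chart_inv c x) 0 j) }.

Section smooth_functions.
Context {R : realType} {m : nat} (M : smooth_manifold R m).
Implicit Types (f g : M -> R) (U : set M).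

Definition smooth_on U f := forall c, atlas c ->
  Cinfty (c @` (chart_dom c `&` U)) (f \o chart_inv c).

Lemma chart_image_open (c : chart R m M) : open (c @` (chart_dom c `&` setT)).
Proof. by rewrite setIT; exact: chart_cod_open. Qed.

Definition smooth_pred : {pred M -> R} := fun f => `[< smooth_on setT f >].

Lemma smooth_subring : subring_closed smooth_pred.
Proof.
split=> [|f g /asboolP sf /asboolP sg|f g /asboolP sf /asboolP sg];
  apply/asboolP => c Ac k; have oc := @chart_image_open c.
- exact: Ck_cst.
- have := CkD oc (sf c Ac k) (CkM oc (Ck_cst k (-1) oc) (sg c Ac k)).
  by apply: Ck_ext => // x _; rewrite mulN1r.
- exact: CkM oc (sf c Ac k) (sg c Ac k).
Qed.

Lemma smooth_submod : submod_closed smooth_pred.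
Proof.
split=> [|a f g /asboolP sf /asboolP sg];
  apply/asboolP => c Ac k; have oc := @chart_image_open c.
- exact: Ck_cst.
- exact: CkD oc (CkM oc (Ck_cst k a oc) (sf c Ac k)) (sg c Ac k).
Qed.

HB.instance Definition _ :=
  GRing.isSubringClosed.Build (M -> R) smooth_pred smooth_subring.
HB.instance Definition _ :=
  GRing.isSubmodClosed.Build R (M -> R) smooth_pred smooth_submod.

(* The ring (and real vector space) of smooth functions on [M]. *)
Record smooth_fun := SmoothFun {
  smooth_val :> M -> R ; _ : smooth_val \in smooth_pred }.
HB.instance Definition _ := [isSub for smooth_val].
HB.instance Definition _ := [Choice of smooth_fun by <:].
HB.instance Definition _ :=
  GRing.SubChoice_isSubComPzRing.Build (M -> R) smooth_pred smooth_fun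
    (GRing.subringClosedP _).
HB.instance Definition _ := [SubZmodule_isSubLmodule of smooth_fun by <:].

End smooth_functions.

Section vector_fields.
Context {R : realType} {m : nat} (M : smooth_manifold R m).
Local Notation C := (smooth_fun M).
Implicit Types f g : C.

(* Vector fields are the derivations of the algebra of smooth functions.  The
   codomain is written [C^o] only to get the scaling of functions by [C]. *)
Definition derivation (D : C -> C^o) :=
  (forall (a : R) f g, D (a *: f + g) = a *: (D f : C) + D g :> C) /\
  (forall f g, D (f * g) = D f * g + f * D g :> C).

Definition derivation_pred : {pred C -> C^o} := fun D => `[< derivation D >].

Lemma derivation_submod : submod_closed derivation_pred.
Proof.
have sE (a : R) (f g : C) p : (a *: f + g) p = a * f p + g p by [].
have mE (f g : C) p : (f * g) p = f p * g p by [].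
have zE p : (0 : C) p = 0 by [].
split=> [|h X Y /asboolP[Xl Xm] /asboolP[Yl Ym]]; apply/asboolP; split.
- by move=> a f g; rewrite scaler0 addr0.
- by move=> f g; rewrite mul0r mulr0 addr0.
- move=> a f g; apply/val_inj/funext => p.
  change ((h * X (a *: f + g) + Y (a *: f + g)) p =
    (a *: (h * X f + Y f) + (h * X g + Y g)) p).
  rewrite Xl Yl.
  change (h p * (a * X f p + X g p) + (a * Y f p + Y g p) =
    a * (h p * X f p + Y f p) + (h p * X g p + Y g p)).
  by rewrite !mulrDr !addrA (mulrCA (h p)); congr (_ + _); rewrite addrAC.
- move=> f g.
  change (h * X (f * g) + Y (f * g) =
    (h * X f + Y f) * g + f * (h * X g + Y g) :> C).
  rewrite Xm Ym !mulrDr !mulrDl !mulrA (mulrC f h) -!addrA.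
  by congr (_ + _); rewrite addrCA.
Qed.
HB.instance Definition _ :=
  GRing.isSubmodClosed.Build C (C -> C^o) derivation_pred derivation_submod.

Record vector_field := VectorField {
  vf_val :> C -> C^o ; _ : vf_val \in derivation_pred }.
HB.instance Definition _ := [isSub for vf_val].
HB.instance Definition _ := [Choice of vector_field by <:].
HB.instance Definition _ := [SubChoice_isSubLmodule of vector_field by <:].

Lemma vf_derivation (X : vector_field) : derivation X.
Proof. by case: X => X /= /asboolP. Qed.

Definition lie_fun (X Y : vector_field) : C -> C^o :=
  fun f => X (Y f) - Y (X f).

Lemma lie_derivation X Y : lie_fun X Y \in derivation_pred.
Proof.
have [Xl Xm] := vf_derivation X; have [Yl Ym] := vf_derivation Y.
have XD f g : X (f + g) = X f + X g :> C by rewrite -[f]scale1r Xl !scale1r.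
have YD f g : Y (f + g) = Y f + Y g :> C by rewrite -[f]scale1r Yl !scale1r.
apply/asboolP; split=> [a f g|f g]; rewrite /lie_fun.
  rewrite Yl Xl Xl Yl scalerBr opprD -!addrA; congr (_ + _).
  by rewrite addrCA.
rewrite Ym Xm XD YD !Xm !Ym; apply/val_inj/funext => p.
change (X (Y f) p * g p + Y f p * X g p + (X f p * Y g p + f p * X (Y g) p) -
  (Y (X f) p * g p + X f p * Y g p + (Y f p * X g p + f p * Y (X g) p)) =
  (X (Y f) p - Y (X f) p) * g p + f p * (X (Y g) p - Y (X g) p)).
by ring.
Qed.

Definition lie_bracket (X Y : vector_field) : vector_field :=
  VectorField (lie_derivation X Y).

(* Tangent vectors at [p] are the derivations at [p] of the algebra of smooth
   functions; the value at [p] of the field [X] is [f |-> X f p]. *)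
Definition tangent_vector (p : M) (v : C -> R) :=
  (forall (a : R) f g, v (a *: f + g) = a * v f + v g) /\
  (forall f g, v (f * g) = v f * g p + f p * v g).

(* The values at [p] of the fields [E] form a basis of the tangent space. *)
Definition basis_at (p : M) (k : nat) (E : 'I_k -> vector_field) :=
  forall v, tangent_vector p v ->
    exists! a : 'rV[R]_k, forall f, v f = \sum_i a 0 i * E i f p.

End vector_fields.

Section geometry.
Context {R : realType} {m : nat} (M : smooth_manifold R m).
Local Notation C := (smooth_fun M).
Local Notation TM := (vector_field M).

(* As usual, tensor fields are given by their C^oo(M)-multilinear action on
   vector fields; one-forms are the elements of [{scalar TM}], fields of
   endomorphisms those of [{linear TM -> TM}]. *)

(* d omega (X, Y) *)
Definition ext_deriv (om : {scalar TM}) (X Y : TM) : C :=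
  X (om Y) - Y (om X) - om (lie_bracket X Y).

Definition closed_form (om : {scalar TM}) := forall X Y, ext_deriv om X Y = 0.

(* A one-form on the open set [U]: only the values on [U] of the functions
   [om X] are relevant, and they are smooth there. *)
Definition local_form (U : set M) (om : TM -> M -> R) :=
  (forall X, smooth_on U (om X)) /\
  (forall p, U p -> forall (f : C) X Y,
     om (f *: X + Y) p = f p * om X p + om Y p).

(* Pseudo-Riemannian metrics of signature (r, s): at each point some basis of
   the tangent space is pseudo-orthonormal, with [r] signs +1 and [s] signs
   -1. In particular [g] is nondegenerate. The third field, which follows from
   bilinearity, makes explicit that [g] is a field of forms on the tangent
   spaces. *)
Record pseudo_riemannian (r s : nat) (g : TM -> TM -> C) : Prop := {
  metric_linear : forall f X Y Z, g (f *: X + Y) Z = f * g X Z + g Y Z ;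
  metric_sym : forall X Y, g X Y = g Y X ;
  metric_pointwise : forall p (X X' Y : TM),
    (forall f, X f p = X' f p) -> g X Y p = g X' Y p ;
  metric_signature : forall p, exists E : 'I_(r + s) -> TM, basis_at p E /\
    forall i j, g (E i) (E j) p = (if (i < r)%N then 1 else -1) *+ (i == j) }.

Record levi_civita (g : TM -> TM -> C) (nabla : TM -> TM -> TM) : Prop := {
  connection_linear : forall f X Y Z,
    nabla (f *: X + Y) Z = f *: nabla X Z + nabla Y Z ;
  connection_add : forall X Y Z, nabla X (Y + Z) = nabla X Y + nabla X Z ;
  connection_leibniz : forall f X Y,
    nabla X (f *: Y) = (X f : C) *: Y + f *: nabla X Y ;
  connection_metric : forall X Y Z : TM,
    X (g Y Z) = g (nabla X Y) Z + g Y (nabla X Z) ;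
  connection_torsion_free : forall X Y,
    nabla X Y - nabla Y X = lie_bracket X Y }.

Definition curvature (nabla : TM -> TM -> TM) (X Y Z : TM) : TM :=
  nabla X (nabla Y Z) - nabla Y (nabla X Z) - nabla (lie_bracket X Y) Z.

Definition flat (nabla : TM -> TM -> TM) :=
  forall X Y Z, curvature nabla X Y Z = 0.

(* (nabla_X J) Y *)
Definition nablaJ (nabla : TM -> TM -> TM) (J : TM -> TM) (X Y : TM) : TM :=
  nabla X (J Y) - J (nabla X Y).

(* J_1, J_2, J_3 are indexed by the elements 0, 1, 2 of ['I_3]; the cyclic
   permutations of (1, 2, 3) are then (al, ordS al, ordS (ordS al)). *)
Definition eps (al : 'I_3) : R := if al == 0 then 1 else -1.

Definition almost_hypercomplex (J : 'I_3 -> {linear TM -> TM}) :=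
  forall al : 'I_3, let be := ordS al in let ga := ordS be in
  forall X, [/\ J al X = J be (J ga X), J al X = - J ga (J be X)
              & J al (J al X) = - X].

(* [g] is the metric of the structure and [gs] the triple (g_1, g_2, g_3). *)
Record NH_metric_structure (n : nat) (J : 'I_3 -> {linear TM -> TM})
    (g : TM -> TM -> C) (gs : 'I_3 -> TM -> TM -> C) : Prop := {
  NH_metric : pseudo_riemannian (2 * n) (2 * n) g ;
  NH_compatible : forall al X Y, g X Y = eps al *: g (J al X) (J al Y) ;
  NH_associated : forall al X Y, gs al X Y = g (J al X) Y ;
  NH_associated' : forall al X Y, gs al X Y = - (eps al *: g X (J al Y)) }.

Definition quaternionic_kahler (nabla : TM -> TM -> TM)
    (J : 'I_3 -> {linear TM -> TM}) :=
  forall p : M, exists U : set M, [/\ open U, U p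
    & exists om : 'I_3 -> TM -> M -> R, (forall al, local_form U (om al)) /\
      forall al : 'I_3, let be := ordS al in let ga := ordS be in
      forall q, U q -> forall X Y (f : C),
        (nablaJ nabla (J al) X Y : TM) f q =
          om ga X q * J be Y f q - om be X q * J ga Y f q].

Definition hyper_kahler (nabla : TM -> TM -> TM)
    (J : 'I_3 -> {linear TM -> TM}) :=
  forall al X Y, nablaJ nabla (J al) X Y = 0.

(* F (X, Y, Z) = g ((nabla_X J) Y, Z) *)
Definition structure_tensor (g : TM -> TM -> C) (nabla : TM -> TM -> TM)
    (J : TM -> TM) (X Y Z : TM) : C := g (nablaJ nabla J X Y) Z.

(* theta (Z) = g^{ij} F (e_i, e_j, Z) for any basis (e_i) of any tangent
   space. *)
Definition lee_form (g : TM -> TM -> C) (nabla : TM -> TM -> TM)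
    (J : TM -> TM) (theta : {scalar TM}) :=
  forall (p : M) (E : 'I_m -> TM), basis_at p E ->
  let ginv := invmx (\matrix_(i, j) g (E i) (E j) p) in
  forall Z, theta Z p =
    \sum_i \sum_j ginv i j * structure_tensor g nabla J (E i) (E j) Z p.

End geometry.

(* Main.v *)
Require Import Defs.
From HB Require Import structures.
From mathcomp Require Import all_boot all_order all_algebra.
From mathcomp Require Import all_classical all_reals all_analysis.
From mathcomp Require Import ring lra.

Set Implicit Arguments.
Unset Strict Implicit.
Unset Printing Implicit Defensive.
Import Order.TTheory GRing.Theory Num.Theory.
Local Open Scope ring_scope.

(** Differentiating the structure equations once more, the terms quadratic in
    omega_1 and those containing a derivative of a field cancel, and there
    remains (lemma [curvature_commutator])
      R(X,Y) J_2 Z - J_2 R(X,Y) Z = d omega_1 (X,Y) J_3 Z.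
    So d omega_1 is the obstruction to the curvature commuting with J_2.

    If R = 0, then d omega_1 (X,Y) annihilates all vector fields, because J_3
    is onto.  A function f = d omega_1 (X,Y) with this property is zero: in
    f f = f X(omega_1 Y) - f Y(omega_1 X) - omega_1 (f [X,Y]) each term
    contains f times a vector field (lemma [ext_deriv_eq0]).

    If d omega_1 = 0, then R(X,Y) commutes with J_2.  It always commutes with
    the parallel J_1, hence it commutes with J_3 = J_1 J_2.  The structures
    J_2 and J_3 are symmetric for g, since they are anti-isometries with square
    -1.  For a symmetric J which commutes with every R(X,Y), the pair symmetry
    of R gives R(JX,Y) = R(X,JY), and the first Bianchi identity improves this
    to R(JX,Y) = J R(X,Y) (lemma [curvature_pure]).  With this purity for
    both J_2 and J_3,
      J_2 J_3 R(X,Y) = R(J_3 X, J_2 Y) = J_3 J_2 R(X,Y),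
    whereas J_2 and J_3 anticommute; so 2 J_1 R(X,Y) = 0 and R = 0.  Finally
    a hyper-Kähler structure would give omega_1(X) J_3 Z = 0 for all X and Z,
    so omega_1(X) Z = 0; with Z = X, omega_1(X)^2 = 0, which is excluded as
    omega_1 is not zero.

    Functions and vector fields are compared by their values in R, so no
    coordinates occur; frames serve only for the nondegeneracy of g. *)

(** * Linear algebra of the second covariant derivative *)

(** [P], [Q] and [N] stand for J applied to the three terms of the curvature,
    [x], [y], [l] for the values of the one-form on X, Y and [X,Y], and [d],
    [e] for the derivatives of these values.  What is symmetric under the
    exchange of X and Y drops out. *)
Lemma second_derivative_cancel (A : comPzRingType) (V : lmodType A)
    (P Q N k kx ky j : V) (x y d e l : A) :
  P + x *: ky + (d *: k + y *: (kx - x *: j))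
    - (Q + y *: kx + (e *: k + x *: (ky - y *: j))) - (N + l *: k)
  = P - Q - N + (d - e - l) *: k.
Proof.
pose z := x *: ky + y *: kx - (x * y) *: j.
have -> : P + x *: ky + (d *: k + y *: (kx - x *: j)) = P + d *: k + z.
  by rewrite /z scalerBr scalerA (mulrC y) [LHS](AC (2*(1*2)) ((1*3)*(2*4*5))).
have -> : Q + y *: kx + (e *: k + x *: (ky - y *: j)) = Q + e *: k + z.
  by rewrite /z scalerBr scalerA [LHS](AC (2*(1*2)) ((1*3)*(4*2*5))).
rewrite opprD addrACA subrr addr0 !scalerBl.
by rewrite (opprD Q) (opprD N) [LHS](AC (2*2*2) ((1*3*5)*(2*4*6))).
Qed.

(** * Smooth functions and vector fields by their values *)

Section pointwise_calculus.
Context {R : realType} {m : nat} (M : smooth_manifold R m).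
Local Notation C := (smooth_fun M).
Local Notation TM := (vector_field M).
Implicit Types (X Y Z : TM) (f h : C) (p : M).

Lemma sfP f h : (forall p, f p = h p) -> f = h.
Proof. by move=> fh; apply/val_inj/funext. Qed.

Lemma vfP X Y : (forall f p, X f p = Y f p) -> X = Y.
Proof. by move=> XY; apply/val_inj/funext => f; apply: sfP => p; exact: XY. Qed.

Lemma sfDE f h p : (f + h) p = f p + h p. Proof. by []. Qed.
Lemma sfNE f p : (- f) p = - f p. Proof. by []. Qed.
Lemma sfME f h p : (f * h) p = f p * h p. Proof. by []. Qed.
Lemma sfZE (a : R) f p : (a *: f) p = a * f p. Proof. by []. Qed.
Lemma sf0E p : (0 : C) p = 0. Proof. by []. Qed.
Definition sfE := (sfDE, sfNE, sfME, sfZE, sf0E).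

Lemma vfDE X Y f p : (X + Y) f p = X f p + Y f p. Proof. by []. Qed.
Lemma vfNE X f p : (- X) f p = - X f p. Proof. by []. Qed.
Lemma vfZE h X f p : (h *: X) f p = h p * X f p. Proof. by []. Qed.
Lemma vf0E f p : (0 : TM) f p = 0. Proof. by []. Qed.
Definition vfE := (vfDE, vfNE, vfZE, vf0E).

Lemma vfD X f h : X (f + h) = X f + X h :> C.
Proof. by have [Xl _] := vf_derivation X; rewrite -[f]scale1r Xl !scale1r. Qed.

Lemma vfB X f h : X (f - h) = X f - X h :> C.
Proof.
have [Xl _] := vf_derivation X.
by rewrite addrC -scaleN1r Xl scaleN1r addrC.
Qed.

(** The first two equations minus the last two give 2 (a - u) = 0. *)
Lemma cyclic_system (a b c u v w : TM) :
  a + v + c = 0 -> b + w + a = 0 -> c + u + b = 0 -> u + v + w = 0 -> a = u.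
Proof.
move=> e1 e2 e3 e4; apply: vfP => f p.
have ev (x y z : TM) : x + y + z = 0 -> x f p + y f p + z f p = 0.
  by move=> e; exact (congr1 (fun U : TM => U f p) e).
move: (ev _ _ _ e1) (ev _ _ _ e2) (ev _ _ _ e3) (ev _ _ _ e4); lra.
Qed.

Lemma lieE X Y f p : lie_bracket X Y f p = X (Y f) p - Y (X f) p.
Proof. by []. Qed.

Lemma lie_jacobi X Y Z :
  lie_bracket X (lie_bracket Y Z) + lie_bracket Y (lie_bracket Z X)
    + lie_bracket Z (lie_bracket X Y) = 0.
Proof.
apply: vfP => f p; rewrite !vfE !lieE.
have e (A B D : TM) : A (lie_bracket B D f) p = A (B (D f)) p - A (D (B f)) p.
  exact (congr1 (fun u : C => u p) (vfB A (B (D f)) (D (B f)))).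
by rewrite !e; ring.
Qed.

End pointwise_calculus.

(** * Symmetries of the curvature tensor *)

Section curvature_symmetries.
Context {R : realType} {m : nat} (M : smooth_manifold R m).
Local Notation C := (smooth_fun M).
Local Notation TM := (vector_field M).
Context (r s : nat) (g : TM -> TM -> C) (nabla : TM -> TM -> TM).
Context (gP : pseudo_riemannian r s g) (nablaP : levi_civita g nabla).
Implicit Types (X Y Z W : TM) (f : C) (p : M).
Local Notation Rm := (curvature nabla).

Lemma metricDl X Y Z : g (X + Y) Z = g X Z + g Y Z.
Proof. by have := metric_linear gP 1 X Y Z; rewrite scale1r mul1r. Qed.

Lemma metric0l Z : g 0 Z = 0.
Proof. by apply: (addrI (g 0 Z)); rewrite -metricDl !addr0. Qed.

Lemma metricZl f X Z : g (f *: X) Z = f * g X Z.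
Proof. by rewrite -[f *: X]addr0 (metric_linear gP) metric0l addr0. Qed.

Lemma metricNl X Z : g (- X) Z = - g X Z.
Proof. by rewrite -scaleN1r metricZl mulN1r. Qed.

Lemma metricDr X Y Z : g Z (X + Y) = g Z X + g Z Y.
Proof. by rewrite !(Defs.metric_sym gP Z) metricDl. Qed.

Lemma metricNr X Z : g Z (- X) = - g Z X.
Proof. by rewrite !(Defs.metric_sym gP Z) metricNl. Qed.

Lemma nabla0r X : nabla X 0 = 0.
Proof.
by apply: (addrI (nabla X 0)); rewrite -(connection_add nablaP) !addr0.
Qed.

Lemma nablaNr X Y : nabla X (- Y) = - nabla X Y.
Proof.
by apply: (addrI (nabla X Y)); rewrite -(connection_add nablaP) !subrr nabla0r.
Qed.

Lemma nabla0l Z : nabla 0 Z = 0.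
Proof.
apply: (addrI (nabla 0 Z)).
by have := connection_linear nablaP 1 0 0 Z; rewrite !scale1r !addr0 => <-.
Qed.

Lemma nablaNl X Z : nabla (- X) Z = - nabla X Z.
Proof.
have := connection_linear nablaP (-1) X 0 Z.
by rewrite !addr0 nabla0l addr0 !scaleN1r.
Qed.

Lemma lie_bracketC X Y : lie_bracket X Y = - lie_bracket Y X.
Proof. by rewrite -!(connection_torsion_free nablaP) opprB. Qed.

Lemma curvature_antisym X Y Z : Rm X Y Z = - Rm Y X Z.
Proof.
rewrite /curvature (lie_bracketC X Y) nablaNl opprK !opprD !opprK.
by rewrite [in RHS]addrC [in RHS](addrC (- _)) [LHS]addrC.
Qed.

(** Vanishing torsion writes each double bracket of the Jacobi identity as
    three second derivatives, which are those of the cyclic sum of the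
    curvature in another order. *)
Lemma curvature_bianchi X Y Z : Rm X Y Z + Rm Y Z X + Rm Z X Y = 0.
Proof.
have T (A B D : TM) : lie_bracket A (lie_bracket B D)
    = nabla A (nabla B D) - nabla A (nabla D B) - nabla (lie_bracket B D) A.
  rewrite -!(connection_torsion_free nablaP) (connection_add nablaP).
  by rewrite nablaNr.
rewrite -(lie_jacobi X Y Z) !T /curvature.
by rewrite [LHS](AC (3*3*3) ((1*8*6)*(4*2*9)*(7*5*3))).
Qed.

(** The function g(Z,W) is differentiated along X and Y in both orders and
    along [X,Y]. *)
Lemma curvature_skew X Y Z W : g (Rm X Y Z) W = - g Z (Rm X Y W).
Proof.
have nn (A B : TM) : A (B (g Z W))
    = g (nabla A (nabla B Z)) W + g (nabla B Z) (nabla A W)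
    + (g (nabla A Z) (nabla B W) + g Z (nabla A (nabla B W))) :> C.
  by rewrite (connection_metric nablaP B) vfD !(connection_metric nablaP A).
have := connection_metric nablaP (lie_bracket X Y) Z W.
move=> e; apply: sfP => p; have := congr1 (fun u : C => u p) e.
rewrite lieE !nn /curvature !(metricDl, metricDr, metricNl, metricNr) !sfE.
lra.
Qed.

(** The octahedron argument: the four cyclic sums over three of the four
    arguments are added, and skewness leaves two terms, each doubled. *)
Lemma curvature_pair_symmetry X Y Z W : g (Rm X Y Z) W = g (Rm Z W X) Y.
Proof.
have b (A B D E : TM) p :
    g (Rm A B D) E p + g (Rm B D A) E p + g (Rm D A B) E p = 0.
  by rewrite -!sfDE -!metricDl curvature_bianchi metric0l.
have sk (A B D E : TM) p : g (Rm A B D) E p = - g (Rm A B E) D p.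
  by rewrite curvature_skew (Defs.metric_sym gP).
have an (A B D E : TM) p : g (Rm A B D) E p = - g (Rm B A D) E p.
  by rewrite curvature_antisym metricNl.
apply: sfP => p.
have := b Y Z X W p; have := b Z X W Y p.
have := b X W Y Z p; have := b W Y Z X p.
have := sk Y Z X W p; have := sk Z X Y W p; have := sk X W Z Y p.
have := sk W Y X Z p; have := sk Y X Z W p; have := sk Z W X Y p.
have := an X Y Z W p; have := an W Z X Y p.
lra.
Qed.

(** At each point the coefficients of X in a pseudo-orthonormal frame are, up
    to sign, its products with the frame. *)
Lemma metric_nondegenerate X : (forall Y, g X Y = 0) -> X = 0.
Proof.
move=> gX0; apply: vfP => f p.
have [E [bE gE]] := metric_signature gP p.
have tX : tangent_vector p (fun h => X h p).
  have [Xl Xm] := vf_derivation X.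
  by split=> [a u v|u v]; rewrite ?Xl ?Xm.
have [a [Xa _]] := bE _ tX.
rewrite Xa vf0E big1 // => j _; suff -> : a 0 j = 0 by rewrite mul0r.
(* The field with constant coefficients which agrees with [X] at [p]. *)
pose V : TM := \sum_i (a 0 i *: (1 : C)) *: E i.
have gV : g V (E j) p = \sum_i a 0 i * g (E i) (E j) p.
  rewrite /V (big_morph (fun U => g U (E j))
    (fun U W => metricDl U W (E j)) (metric0l _)).
  rewrite (big_morph (fun u : C => u p) (fun u v => sfDE u v p) (sf0E p)).
  apply: eq_bigr => i _.
  by rewrite metricZl sfME sfZE [X in _ * X * _]/(1 : R) mulr1.
have XV h : X h p = V h p.
  rewrite Xa /V (big_morph (fun U : TM => U h p)
    (fun U W => vfDE U W h p) (vf0E h p)).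
  by apply: eq_bigr => i _; rewrite vfZE sfZE [X in _ * X * _]/(1 : R) mulr1.
move: gV; rewrite -(metric_pointwise gP (E j) XV) gX0 sf0E (bigD1 j) //=.
rewrite big1 => [|i nij].
  by rewrite gE eqxx addr0; case: ifP => _; rewrite ?mulr1 ?mulrN1 => e; lra.
by rewrite gE (negbTE nij) mulr0.
Qed.

(** The pair symmetry carries J from the third argument of R, where it is
    balanced by the metric, to the first two; the Bianchi identities for
    (JX,Y,Z) and its cyclic permutations then form a linear system for the
    R(JX,Y)Z, whose solution is the purity of R. *)
Lemma curvature_pure (J : {linear TM -> TM}) :
  (forall X Y, g (J X) Y = g X (J Y)) ->
  (forall X Y Z, Rm X Y (J Z) = J (Rm X Y Z)) ->
  forall X Y Z, Rm (J X) Y Z = J (Rm X Y Z).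
Proof.
move=> gJ RJ.
have bal X Y Z : Rm (J X) Y Z = Rm X (J Y) Z.
  apply/eqP; rewrite -subr_eq0; apply/eqP; apply: metric_nondegenerate => W.
  rewrite metricDl metricNl curvature_pair_symmetry RJ gJ.
  by rewrite -curvature_pair_symmetry subrr.
move=> X Y Z.
have cyc A B D : Rm (J A) B D + J (Rm B D A) + Rm (J D) A B = 0.
  by rewrite -RJ (bal D A B); exact: curvature_bianchi.
apply: (cyclic_system (cyc X Y Z) (cyc Y Z X) (cyc Z X Y)).
by rewrite -!linearD curvature_bianchi linear0.
Qed.

(** Purity lets J and K leave R(KX,JY) in either order, so JK and KJ agree on
    the values of R while they are opposite. *)
Lemma flat_of_anticommuting_pure (J K : {linear TM -> TM}) :
  (forall X Y, g (J X) Y = g X (J Y)) -> (forall X Y, g (K X) Y = g X (K Y)) ->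
  (forall X Y Z, Rm X Y (J Z) = J (Rm X Y Z)) ->
  (forall X Y Z, Rm X Y (K Z) = K (Rm X Y Z)) ->
  (forall X, J (K X) = - K (J X)) -> (forall X, J (K X) = 0 -> X = 0) ->
  flat nabla.
Proof.
move=> gJ gK RJ RK JK inj X Y Z; apply: inj.
have pJ := curvature_pure gJ RJ; have pK := curvature_pure gK RK.
have bal A B D : Rm A (J B) D = J (Rm A B D).
  by rewrite curvature_antisym pJ curvature_antisym linearN opprK.
(* Both sides are the curvature of [K X] and [J Y] applied to [Z]. *)
have e : J (K (Rm X Y Z)) = K (J (Rm X Y Z)) by rewrite -pK -bal pK bal.
apply: vfP => f p; have := congr1 (fun V : TM => V f p) (JK (Rm X Y Z)).
by rewrite -e vfE vf0E; lra.
Qed.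

Lemma curvature_commutes (J : {linear TM -> TM}) :
  (forall X Y, nablaJ nabla J X Y = 0) ->
  forall X Y Z, Rm X Y (J Z) = J (Rm X Y Z).
Proof.
move=> J0 X Y Z; have e A B : nabla A (J B) = J (nabla A B).
  by apply/eqP; rewrite -subr_eq0; apply/eqP; exact: J0.
by rewrite /curvature !e !linearB.
Qed.

(** The rotation of J and K into each other by the connection form [al] is
    abelian, which is why the curvature of this form is its differential. *)
Lemma curvature_commutator (J K : {linear TM -> TM}) (al : {scalar TM}) :
  (forall X Y, nablaJ nabla J X Y = al X *: K Y) ->
  (forall X Y, nablaJ nabla K X Y = - (al X *: J Y)) ->
  forall X Y Z, Rm X Y (J Z) = J (Rm X Y Z) + ext_deriv al X Y *: K Z.
Proof.
move=> DJ DK X Y Z.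
have eJ A B : nabla A (J B) = J (nabla A B) + al A *: K B.
  by rewrite -DJ /nablaJ addrC subrK.
have eK A B : nabla A (K B) = K (nabla A B) - al A *: J B.
  by rewrite -DK /nablaJ addrC subrK.
rewrite /curvature !(eJ, connection_add nablaP, connection_leibniz nablaP, eK).
rewrite second_derivative_cancel; congr (_ + _).
by rewrite -!linearB.
Qed.

End curvature_symmetries.

(** * Functions that annihilate all vector fields *)

Section faithfulness.
Context {R : realType} {m : nat} (M : smooth_manifold R m).
Local Notation C := (smooth_fun M).
Local Notation TM := (vector_field M).

Lemma sqr_sf_eq0 (f : C) : f * f = 0 -> f = 0.
Proof.
move=> ff0; apply: sfP => p; apply/eqP.
rewrite -[_ == _]orbb -mulf_eq0; apply/eqP.
exact (congr1 (fun u : C => u p) ff0).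
Qed.

(** Applied to Z = X, the one-form turns the hypothesis into the vanishing of
    the square of its value.  No local frame is involved, so the argument
    covers zero-dimensional manifolds as well. *)
Lemma form_value_eq0 (om : {scalar TM}) (X : TM) :
  (forall Z : TM, om X *: Z = 0) -> om X = 0.
Proof.
move=> X0; apply: sqr_sf_eq0.
by have := linearZ_LR om (om X) X; rewrite X0 linear0.
Qed.

(** Every term of the function is the value of the one-form on a field, or a
    derivative along a field; multiplied by the function, each is zero. *)
Lemma ext_deriv_eq0 (om : {scalar TM}) (X Y : TM) :
  (forall Z : TM, ext_deriv om X Y *: Z = 0) -> ext_deriv om X Y = 0.
Proof.
set f := ext_deriv om X Y => f0; apply: sqr_sf_eq0.
have fD (Z : TM) h : f * (Z h : C) = 0.
  by move: (congr1 (fun V : TM => V h : C) (f0 Z)).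
have fom Z : f * om Z = 0 by have := linearZ_LR om f Z; rewrite f0 linear0.
by rewrite {2}/f /ext_deriv !mulrBr !fD fom !subrr.
Qed.

End faithfulness.

(** * The flatness criterion *)

Theorem proposition4p4 (R : realType) (n : nat) (M : smooth_manifold R (4 * n))
    (J : 'I_3 -> {linear vector_field M -> vector_field M})
    (g : vector_field M -> vector_field M -> smooth_fun M)
    (gs : 'I_3 -> vector_field M -> vector_field M -> smooth_fun M)
    (nabla : vector_field M -> vector_field M -> vector_field M)
    (omega1 theta2 theta3 : {scalar vector_field M})
    (J1 := J 0) (J2 := J 1) (J3 := J 2%:R)
    (HJ : almost_hypercomplex J)
    (HG : NH_metric_structure n J g gs)
    (Hnabla : levi_civita g nabla)
    (HQK : quaternionic_kahler nabla J)
    (Homega1_neq0 : exists X : vector_field M, omega1 X <> 0)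
    (HJ1 : forall X Y, nablaJ nabla J1 X Y = 0)
    (HJ2 : forall X Y, nablaJ nabla J2 X Y = omega1 X *: J3 Y)
    (HJ3 : forall X Y, nablaJ nabla J3 X Y = - (omega1 X *: J2 Y))
    (Htheta2 : lee_form g nabla J2 theta2)
    (Htheta3 : lee_form g nabla J3 theta3)
    (Homega1_theta2 : forall X, omega1 X = - theta2 (J3 X))
    (Homega1_theta3 : forall X, omega1 X = theta3 (J2 X)) :
  (flat nabla /\ ~ hyper_kahler nabla J) <-> closed_form omega1.
Proof.
have [gP _ gsl gsr] := HG.
have o0 : ordS (0 : 'I_3) = 1 by apply: val_inj.
have o1 : ordS (1 : 'I_3) = 2%:R by apply: val_inj.
have o2 : ordS (2%:R : 'I_3) = 0 by apply: val_inj.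
have J23 X : J1 X = J2 (J3 X) by have [] := HJ 0 X; rewrite o0 o1.
have J32 X : J1 X = - J3 (J2 X) by have [] := HJ 0 X; rewrite o0 o1.
have J11 X : J1 (J1 X) = - X by have [] := HJ 0 X.
have J12 X : J3 X = J1 (J2 X) by have [] := HJ 2%:R X; rewrite o2 o0.
have J33 X : J3 (J3 X) = - X by have [] := HJ 2%:R X.
have symJ al X Y : al != 0 -> g (J al X) Y = g X (J al Y).
  by move=> al0; rewrite -gsl gsr /eps (negbTE al0) scaleN1r opprK.
have RJ2 := curvature_commutator Hnabla HJ2 HJ3.
split=> [[Rm0 _] X Y|dom0].
  apply: ext_deriv_eq0 => Z; have := RJ2 X Y (J3 Z).
  rewrite !Rm0 linear0 add0r J33 scalerN => /esym/eqP.
  by rewrite oppr_eq0 => /eqP.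
split=> [|hK]; last first.
  have [X] := Homega1_neq0; apply; apply: form_value_eq0 => Z.
  have := HJ2 X (J3 Z).
  by rewrite hK J33 scalerN => /esym/eqP; rewrite oppr_eq0 => /eqP.
have RJ1 := curvature_commutes HJ1.
have {}RJ2 X Y Z : curvature nabla X Y (J2 Z) = J2 (curvature nabla X Y Z).
  by rewrite RJ2 dom0 scale0r addr0.
apply: (flat_of_anticommuting_pure gP Hnabla (J := J2) (K := J3)) => //.
- by move=> X Y; exact: symJ.
- by move=> X Y; exact: symJ.
- by move=> X Y Z; rewrite !J12 RJ1 RJ2.
- by move=> X; rewrite -J23 J32.
- move=> X; rewrite -J23 => /(congr1 J1); rewrite J11 linear0 => /eqP.
  by rewrite oppr_eq0 => /eqP.
Qed.
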